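(* Let $n,s,k \in \mathbb{Z}^+$ with $1 \leq s \leq n-2$ and $k \leq \binom{n}{2}$. If $\gcd(s,n) = 1$, then there is an $s$-overlap cycle for $\mathcal{W}_k(n)$.
   Context: $\mathcal{W}(n)$ denotes the set of weak orders on $[n]$ (transitive and complete relations), represented as words: $\mathcal{W}(n)$ is the set of all words $w_1w_2\ldots w_n$ of length $n$ over the nonnegative integers such that $\{w_1,\dots,w_n\} = \{0,1,\dots,h\}$ for some $h$ with $0 \le h \le n-1$ (here $w_j$ is the height of element $j$ in the weak order). The weight of $w = w_1\ldots w_n$ is $\sum_{i=1}^n w_i$, and $\mathcal{W}_k(n)$ is the set of $w \in \mathcal{W}(n)$ of weight $k$. An $s$-overlap cycle ($s$-ocycle) for a set of words of length $n$ is a cyclically ordered listing of the words in the set, each appearing exactly once, such that the last $s$ letters of each word are the first $s$ letters (in the same order) of its successor in the listing (the successor of the last word being the first word). *)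

(* Defs.v *)
From mathcomp Require Import all_boot.

Set Implicit Arguments.
Unset Strict Implicit.
Unset Printing Implicit Defensive.

(** Weak orders on [n], encoded as words of heights: the letter set of [w] is
    {0, ..., h} for some 0 <= h <= n - 1. *)
Definition weak_order (n : nat) (w : n.-tuple nat) : Prop :=
  exists2 h, h < n & forall a : nat, (a \in w) = (a <= h).

Definition weight (n : nat) (w : n.-tuple nat) : nat := \sum_(i < n) tnth w i.

Definition weak_order_wt (k n : nat) (w : n.-tuple nat) : Prop :=
  weak_order w /\ weight w = k.

(** Meaningful for [s <= n]: [drop (n - s) u] is then the word formed by the
    last [s] letters of [u]. *)
Definition overlap (s n : nat) : rel (n.-tuple nat) :=
  fun u v => drop (n - s) u == take s v :> seq nat.

(** [cycle] also relates the last word of the listing to the first one. *)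
Definition is_ocycle (s n : nat) (A : n.-tuple nat -> Prop)
    (c : seq (n.-tuple nat)) : Prop :=
  [/\ uniq c, forall w, w \in c <-> A w & cycle (@overlap s n) c].

(* Main.v *)
Require Import Defs.
From mathcomp Require Import all_boot fingroup perm zify.

(** The words are the edges of a transition digraph, from their [s]-letter
    prefix to their [s]-letter suffix, and an ocycle is an Eulerian circuit.
    Rotating each word by [d = n - s] letters already gives a permutation in
    which every word overlaps its image; a permutation of this kind with as few
    orbits as possible has any two words with a common suffix in the same orbit.
    It remains to link all words by rotations and changes of the first [d]
    letters.  Since [gcd(d, n) = 1], all rotations are available, and since
    [d >= 2], any two cyclically adjacent letters may be replaced; transposing
    such letters gives all permutations of a word.  Replacing a repeated letter
    [x] and the maximal letter [h >= x + 2] by [x + 1] and [h - 1] decreases the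
    sum of squares, and ends in a word whose letters other than the two largest
    are simple.  Its length and weight determine such a word up to order. *)

Set Implicit Arguments.
Unset Strict Implicit.
Unset Printing Implicit Defensive.

(** * Eulerian circuits from permutations with few orbits *)

(** With [T] as the edges of a digraph, [r] splits them into closed trails. In a splitting with the
    fewest trails, two trails through a common vertex cannot exist: they could be spliced there. *)
Lemma successor_perm_joining (T : finType) (V : eqType) (src tgt : T -> V)
    (r : {perm T}) :
    (forall x, tgt x = src (r x)) ->
  exists2 p : {perm T}, forall x, tgt x = src (p x)
    & forall x y, tgt x = tgt y -> x \in porbit p y.
Proof.
move=> tgt_r; pose follows (q : {perm T}) := [forall x, tgt x == src (q x)].
have follows_r : follows r by apply/forallP => x; apply/eqP.
case: (arg_minnP (fun q : {perm T} => #|porbits q|) follows_r).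
move=> p /forallP p_ok p_min.
exists p => [x | x y tgt_xy]; first exact/eqP.
apply/negPn/negP => x_notin.
have neq_xy : x != y by apply: contraNneq x_notin => ->; rewrite porbit_id.
(* Exchanging the successors of [x] and [y] merges their orbits. *)
have /p_min : follows (tperm x y * p)%g.
  apply/forallP => z; rewrite permM -(eqP (p_ok _)).
  by case: tpermP => [->|->|]; rewrite ?tgt_xy.
by have := porbits_mul_tperm p x y; rewrite x_notin neq_xy /=; lia.
Qed.

Lemma one_porbit_cycle (T : finType) (e : rel T) (p : {perm T}) :
    (forall x, e x (p x)) -> (forall x y, x \in porbit p y) ->
  exists c : seq T, [/\ uniq c, forall x, x \in c & path.cycle e c].
Proof.
move=> e_p one_orbit; case: (pickP T) => [x0 _ | T0]; last first.
  by exists [::]; split=> // x; have := T0 x.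
exists (fingraph.orbit p x0); split=> [|x|]; first exact: orbit_uniq.
- rewrite -fconnect_orbit; have /porbitP[i ->] := one_orbit x x0.
  by rewrite permX fconnect_iter.
- by apply: sub_cycle (cycle_orbit (@perm_inj _ p) x0) => x _ /eqP <-.
Qed.

(** * Words linked by rotations and changes of prefix *)

(** The two generating moves are those that will be shown to stay inside an orbit of the successor
    permutation, by induction on this relation. *)
Inductive linked (A : pred (seq nat)) (d : nat) : seq nat -> seq nat -> Prop :=
| linked_refl u : A u -> linked A d u u
| linked_sym u v : linked A d u v -> linked A d v u
| linked_trans u v w : linked A d u v -> linked A d v w -> linked A d u w
| linked_rotd u : A u -> linked A d u (rot d u)
| linked_drop u v : A u -> A v -> drop d u = drop d v -> linked A d u v.

Definition perm_closed (A : pred (seq nat)) :=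
  forall u v : seq nat, perm_eq u v -> A u = A v.

Lemma perm_closed_rot (A : pred (seq nat)) i u :
  perm_closed A -> A (rot i u) = A u.
Proof. by move=> permA; apply: permA; rewrite perm_rot. Qed.

Lemma linked_rot (A : pred (seq nat)) d n i u :
    perm_closed A -> 0 < d < n -> coprime d n -> A u -> size u = n -> i <= n ->
  linked A d u (rot i u).
Proof.
move=> permA d_n co_dn Au size_u i_n.
have linked_mul j : linked A d u (rot (d * j %% n) u).
  elim: j => [|j IHj]; first by rewrite muln0 mod0n rot0; apply: linked_refl.
  apply: linked_trans IHj _.
  have -> : rot (d * j.+1 %% n) u = rot d (rot (d * j %% n) u).
    have lt_jn : d * j %% n < n by rewrite ltn_mod; lia.
    rewrite rot_add_mod ?size_u; [|lia|lia].
    rewrite mulnS -modnDmr; case: leqP => [|gt_n].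
      (* If the two amounts add up to exactly [n], the composite is [rot n] and not [rot 0]; both
         are the identity. *)
      rewrite leq_eqVlt => /predU1P[-> | lt_n]; last first.
        by rewrite modn_small.
      by rewrite modnn rot0 -size_u rot_size.
    congr rot; rewrite -{1}(subnK (ltnW gt_n)) modnDr modn_small //; lia.
  by apply: linked_rotd; rewrite perm_closed_rot.
have [i_eq | i_ltn] := eqVneq i n.
  by rewrite i_eq -size_u rot_size; apply: linked_refl.
(* Here [b * d = 1 + a * n], so [b * i] rotations by [d] amount to one rotation by [i]. *)
have [a _ /dvdnP[b d_inv]] := @Bezoutl d n ltac:(lia).
have := linked_mul (b * i).
rewrite (eqP co_dn) in d_inv.
rewrite mulnA [d * b]mulnC -d_inv mulnDl mul1n mulnAC -modnDmr modnMl addn0.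
by rewrite modn_small //; lia.
Qed.

(** Adjacent transpositions generate all permutations: [swap] performs one, [shift] carries a letter
    across a block, and [main] turns [u] into [v] letter by letter behind a settled prefix [p]. *)
Lemma linked_perm (A : pred (seq nat)) d n u v :
    perm_closed A -> (forall w, A w -> size w = n) ->
    1 < d < n -> coprime d n -> A u -> perm_eq u v ->
  linked A d u v.
Proof.
move=> permA sizeA d_n co_dn.
have rotate i w : A w -> i <= n -> linked A d w (rot i w).
  by move=> Aw; apply: linked_rot; rewrite ?sizeA //; lia.
have swap p x y q : A (p ++ x :: y :: q) ->
    linked A d (p ++ x :: y :: q) (p ++ y :: x :: q).
  (* Rotate the two letters to the front, where they may be changed freely. *)
  move=> Axy; have Ayx : A (p ++ y :: x :: q).
    rewrite -(permA _ _ _ : A (p ++ x :: y :: q) = _) //.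
    by rewrite perm_cat2l (perm_catCA [:: x] [:: y]).
  have p_n : size p <= n by rewrite -(sizeA _ Axy) size_cat leq_addr.
  apply: linked_trans (rotate _ _ Axy p_n) _; apply: linked_sym.
  apply: linked_trans (rotate _ _ Ayx p_n) _.
  rewrite !rot_size_cat; apply: linked_drop.
  - by rewrite (permA _ _ _ : _ = A (p ++ y :: x :: q)) // perm_catC.
  - by rewrite (permA _ _ _ : _ = A (p ++ x :: y :: q)) // perm_catC.
  - by case: (d) d_n => [|[|d']].
have shift x q v1 : forall p, A (p ++ x :: v1 ++ q) ->
    linked A d (p ++ x :: v1 ++ q) (p ++ v1 ++ x :: q).
  elim: v1 => [|y v1 IHv] p Ap; first exact: linked_refl.
  apply: linked_trans (swap _ _ _ _ Ap) _.
  have := IHv (rcons p y); rewrite !cat_rcons; apply.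
  rewrite (permA _ _ _ : _ = A (p ++ x :: (y :: v1) ++ q)) //.
  by rewrite perm_cat2l (perm_catCA [:: y] [:: x]).
suff main p : A (p ++ u) -> perm_eq u v -> linked A d (p ++ u) (p ++ v).
  by move=> Au; apply: (main [::]).
elim: u v p => [|x u IHu] v p Au.
  by rewrite perm_sym => /perm_nilP->; apply: linked_refl.
move=> uv; have xv : x \in v by rewrite -(perm_mem uv) mem_head.
case/path.splitPr: v / xv uv => v1 v2 uv.
have u_v12 : perm_eq u (v1 ++ v2).
  by rewrite -(perm_cons x) (perm_trans uv) // (perm_catCA v1 [:: x]).
have := IHu (v1 ++ v2) (rcons p x); rewrite !cat_rcons => /(_ Au u_v12) link.
apply: linked_trans link (shift _ _ _ _ _).
by rewrite -(permA _ _ _ : A (p ++ x :: u) = _) // perm_cat2l perm_cons.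
Qed.

(** * Weak orders as words closed downwards *)

(* For [0 < n], the words of [weak_order_wt k n]: a nonempty letter set is
   {0, ..., h} if and only if it is closed downwards. *)
Definition word (n k : nat) : pred (seq nat) := fun w =>
  [&& size w == n, sumn w == k & all (fun a => all (mem w) (iota 0 a)) w].

Lemma wordP n k w :
  reflect [/\ size w = n, sumn w = k
            & forall a j : nat, a \in w -> j <= a -> j \in w]
          (word n k w).
Proof.
apply: (iffP and3P) => [[/eqP size_w /eqP sum_w down] | [-> -> down]]; split=> //.
  move=> a j aw; rewrite leq_eqVlt => /predU1P[-> // | lt_ja].
  by have /allP/(_ j) := allP down _ aw; rewrite mem_iota => /(_ lt_ja).
apply/allP => a aw; apply/allP => j; rewrite mem_iota /= => /ltnW.
exact: down.
Qed.

Lemma word_perm_closed n k : perm_closed (word n k).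
Proof.
move=> u v uv; rewrite /word (perm_size uv) (perm_sumn uv) (perm_all _ uv).
congr [&& _, _ & _]; apply: eq_all => a; apply: eq_all => j.
exact: perm_mem uv j.
Qed.

(** Positive weight forces a positive letter, so the maximum has a predecessor [h], the second
    largest height. *)
Lemma word_max n k w : 0 < k -> word n k w ->
  exists h, forall j : nat, (j \in w) = (j <= h.+1).
Proof.
move=> k_gt0 /wordP[_ sum_w down].
have [h hw h_max] : exists2 h, h \in w & forall j : nat, j \in w -> j <= h.
  have /hasP[a aw _] : has (fun=> true) w.
    by case: w sum_w {down} => //= sum_w; rewrite -sum_w in k_gt0.
  have bnd : forall j, j \in w -> j <= sumn w.
    move=> j jw; rewrite (perm_sumn (perm_to_rem jw)) /=; exact: leq_addr.
  by case: (ex_maxnP (ex_intro _ a aw) bnd) => h; exists h.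
case: h => [|h] in hw h_max.
  have w0 : sumn w = 0.
    rewrite sumnE big_seq big1 // => j /h_max; lia.
  lia.
by exists h => j; apply/idP/idP => [/h_max | /(down _ _ hw)].
Qed.

(** * Reduction to staircases *)

(** The normal form of a word, for positive [a] and [b]: only the two largest letters may repeat. *)
Definition staircase (h a b : nat) : seq nat :=
  iota 0 h ++ nseq a h ++ nseq b h.+1.

(** At a fixed length the weight strictly increases with [h], whatever the positive multiplicities;
    for equal [h] it increases with [b]. *)
Lemma staircase_uniq h1 a1 b1 h2 a2 b2 :
    0 < a1 -> 0 < b1 -> 0 < a2 -> 0 < b2 ->
    size (staircase h1 a1 b1) = size (staircase h2 a2 b2) ->
    sumn (staircase h1 a1 b1) = sumn (staircase h2 a2 b2) ->
  staircase h1 a1 b1 = staircase h2 a2 b2.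
Proof.
rewrite /staircase !size_cat !sumn_cat !sumn_nseq !size_iota !size_nseq.
pose tri h := sumn (iota 0 h); rewrite -!/(tri _).
have triS h : tri h.+1 = tri h + h.
  by rewrite /tri -addn1 iotaD sumn_cat /= addn0.
have lt_sum h a b h' a' b' : h < h' -> 0 < a -> 0 < b' ->
    h + (a + b) = h' + (a' + b') ->
    tri h + (h * a + h.+1 * b) < tri h' + (h' * a' + h'.+1 * b').
  move=> hh' a_gt0 b'_gt0; elim: h' hh' a' b' b'_gt0 => // h' IHh.
  rewrite ltnS leq_eqVlt => /predU1P[<- | hh'] a' b' b'_gt0 eq_n.
    rewrite triS; nia.
  (* Lowering each [h'.+2] to [h'.+1] gives the staircase at [h'] with multiplicities [1] and
     [a' + b'], of equal length and smaller weight. *)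
  have := IHh hh' 1 (a' + b') ltac:(lia) ltac:(lia); rewrite triS; nia.
move=> a1_gt0 b1_gt0 a2_gt0 b2_gt0 eq_size eq_sum.
have h12 : h1 = h2.
  case: (ltngtP h1 h2) => // [/lt_sum lt12 | /lt_sum lt21].
    by have := lt12 _ b1 a2 b2 a1_gt0 b2_gt0 eq_size; lia.
  by have := lt21 _ b2 a1 b1 a2_gt0 b1_gt0 (esym eq_size); lia.
have b12 : b1 = b2 by rewrite h12 in eq_size eq_sum; nia.
by rewrite -h12 -b12; congr (_ ++ (nseq _ _ ++ _)); lia.
Qed.

Lemma linked_staircase n d k u :
    0 < k -> 1 < d < n -> coprime d n -> word n k u ->
  exists h a b, [/\ 0 < a, 0 < b, word n k (staircase h a b)
                  & linked (word n k) d u (staircase h a b)].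
Proof.
move=> k_gt0 d_n co_dn.
have permA := @word_perm_closed n k.
have link_perm u' v : word n k u' -> perm_eq u' v -> linked (word n k) d u' v.
  by apply: linked_perm d_n co_dn => // w /wordP[].
have [m] := ubnP (\sum_(i <- u) i ^ 2); elim: m => // m IHm in u * => le_um Au.
have [h mem_u] := word_max k_gt0 Au.
have [size_u sum_u down_u] := wordP _ _ _ Au.
case: (boolP (has (fun x => 1 < count_mem x u) (iota 0 h)))
  => [/hasP[x] | /hasPn simple].
  (* The maximum is [h.+1], so the pair [x], [h.+1] is to become [x.+1], [h]. *)
  rewrite mem_iota /= add0n => lt_xh x2.
  have ux : perm_eq u (x :: rem x u) by apply/perm_to_rem; rewrite mem_u; lia.
  have /perm_to_rem uh : h.+1 \in rem x u.
    by apply: rem_mem; rewrite ?mem_u //; lia.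
  set t := rem h.+1 (rem x u) in uh.
  have u_t : perm_eq u [:: x, h.+1 & t] by rewrite (perm_trans ux) // perm_cons.
  have xt : x \in t.
    have /seq.permP/(_ (pred1 x)) := u_t; move: x2 => /[swap] -> /=.
    by rewrite eqxx (_ : h.+1 == x = false) 1?add0n -?has_pred1 ?has_count //; lia.
  have Anew : word n k [:: x.+1, h & t].
    apply/wordP; split.
    - by rewrite -size_u (perm_size u_t).
    - by rewrite -sum_u (perm_sumn u_t) /=; lia.
    (* A second copy of [x] remains in [t], so the only letter that can disappear is [h.+1]. *)
    have in_new j : j <= h -> j \in [:: x.+1, h & t].
      move=> le_jh; have : j \in u by rewrite mem_u leqW.
      rewrite (perm_mem u_t) !in_cons => /or3P[/eqP-> | /eqP j_h | ->].
      - by rewrite xt !orbT.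
      - by move: le_jh; rewrite j_h ltnn.
      - by rewrite !orbT.
    move=> a j; rewrite inE => /predU1P[-> | a_in] le_ja.
      by apply: in_new; lia.
    move: a_in; rewrite inE => /predU1P[a_h | a_t].
      by apply: in_new; rewrite -a_h.
    have : j <= h.+1.
      by apply: leq_trans le_ja _; rewrite -mem_u (perm_mem u_t) !inE a_t !orbT.
    rewrite leq_eqVlt => /predU1P[j_h | ]; last exact: in_new.
    have a_h : a <= h.+1 by rewrite -mem_u (perm_mem u_t) !inE a_t !orbT.
    by rewrite !inE (_ : j = a) ?a_t ?orbT //; lia.
  (* The sum of squares drops by [2 * (h - x)]. *)
  have lt_new : \sum_(i <- [:: x.+1, h & t]) i ^ 2 < m.
    rewrite -ltnS; apply: leq_trans le_um.
    by rewrite ltnS (perm_big _ u_t) !big_cons /=; nia.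
  have [h' [a [b [a_gt0 b_gt0 Ast link]]]] := IHm _ lt_new Anew.
  exists h', a, b; split=> //; apply: linked_trans link.
  apply: linked_trans (link_perm _ _ Au u_t) _.
  apply: linked_drop => //; first by rewrite -(permA _ _ u_t).
  by case: (d) d_n => [|[|d']].
(* Now each letter below [h] occurs exactly once, so sorting [u] yields a staircase. *)
have cnt_gt0 j : j <= h.+1 -> 0 < count_mem j u.
  by rewrite -has_count has_pred1 mem_u.
have u_stairs : perm_eq u (staircase h (count_mem h u) (count_mem h.+1 u)).
  apply/allP => x _; rewrite /= /staircase !count_cat !count_nseq /=.
  rewrite (@count_uniq_mem _ (iota 0 h)) ?iota_uniq // mem_iota add0n leq0n /=.
  rewrite !(eq_sym _ x); case: (ltngtP x h) => [lt_xh | lt_hx | ->].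
  - have := simple x; rewrite mem_iota -leqNgt => /(_ lt_xh).
    have := cnt_gt0 x ltac:(lia); rewrite (ltn_eqF (leqW lt_xh : x < h.+1)).
    by rewrite !mul0n !addn0 eqn_leq => -> ->.
  - case: (eqVneq x h.+1) => [-> | neq_x]; first by rewrite mul1n.
    by have /count_memPn-> : x \notin u by rewrite mem_u; lia.
  - by rewrite (ltn_eqF (ltnSn h)) mul1n mul0n addn0.
exists h, (count_mem h u), (count_mem h.+1 u); split; rewrite ?cnt_gt0 //.
  by rewrite -(permA _ _ u_stairs).
exact: link_perm.
Qed.

Lemma linked_words n d k u v :
    0 < k -> 1 < d < n -> coprime d n -> word n k u -> word n k v ->
  linked (word n k) d u v.
Proof.
move=> k_gt0 d_n co_dn Au Av.
have [h1 [a1 [b1 [a1_gt0 b1_gt0 A1 link_u]]]] :=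
  linked_staircase k_gt0 d_n co_dn Au.
have [h2 [a2 [b2 [a2_gt0 b2_gt0 A2 link_v]]]] :=
  linked_staircase k_gt0 d_n co_dn Av.
have [size1 sum1 _] := wordP _ _ _ A1; have [size2 sum2 _] := wordP _ _ _ A2.
apply: linked_trans link_u _.
rewrite (@staircase_uniq h1 a1 b1 h2 a2 b2) ?size1 ?sum1 //.
exact: linked_sym.
Qed.

(** * Transfer to a finite type and construction of the ocycle *)

(** A letter [a] brings along the [a.+1] distinct letters up to [a], which must fit into [n]
    places. *)
Lemma word_letter_lt n k w a : word n k w -> a \in w -> a < n.
Proof.
move=> /wordP[<- _ down] aw; rewrite -(size_iota 0 a.+1).
apply: uniq_leq_size (iota_uniq _ _) _ => j.
by rewrite mem_iota ltnS; apply: down.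
Qed.

Lemma weak_order_wtP n k (w : n.-tuple nat) :
  0 < n -> weak_order_wt k w <-> word n k w.
Proof.
have weightE : weight w = sumn w by rewrite sumnE [in RHS]big_tuple.
move=> n_gt0; split=> [[[h _ mem_w] wt_w] | Aw].
  apply/wordP; split=> [|| a j]; rewrite ?size_tuple -?weightE //.
  by rewrite !mem_w => le_ah /leq_trans; apply.
have [size_w sum_w down] := wordP _ _ _ Aw; split; last by rewrite weightE.
have mem0 : 0 \in w := down _ 0 (mem_tnth (Ordinal n_gt0) w) (leq0n _).
have letter_le a : a \in w -> a <= n by move/(word_letter_lt Aw)/ltnW.
case: (ex_maxnP (ex_intro _ 0 mem0) letter_le) => h hw h_max.
exists h => [|a]; first exact: word_letter_lt Aw hw.
by apply/idP/idP => [/h_max | /(down _ _ hw)].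
Qed.

Theorem theorem4p3 (n s k : nat) (n_gt0 : 0 < n) (s_gt0 : 0 < s) (k_gt0 : 0 < k)
  (s_le : s <= n - 2) (k_le : k <= 'C(n, 2)) (co_sn : gcdn s n = 1) :
  exists c : seq (n.-tuple nat), is_ocycle s (@weak_order_wt k n) c.
Proof.
set d := n - s; have d_n : 1 < d < n by lia.
have co_dn : coprime d n.
  have n_sd : n = s + d by lia.
  by rewrite /coprime n_sd gcdnDr gcdnC -(gcdnDl s d) -n_sd co_sn.
(* All letters are below [n], so the words can be encoded in a finite type, on which permutations
   are available. *)
pose T := {t : n.-tuple 'I_n | word n k (map val t)}.
pose letters (x : T) := [tuple of map val (val x)] : n.-tuple nat.
have letters_inj : injective letters.
  by move=> x y /(congr1 val)/(inj_map val_inj)/val_inj/val_inj.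
have letters_word (x : T) : word n k (letters x) by exact: valP x.
have letters_onto w : word n k w -> exists x, letters x = w :> seq nat.
  move=> Aw; have size_t : size (pmap (insub : nat -> option 'I_n) w) == n.
    rewrite size_pmap_sub; have [size_w _ _] := wordP _ _ _ Aw.
    by rewrite -[X in _ == X]size_w -all_count; apply/allP => a /(word_letter_lt Aw).
  have t_w : map val (Tuple size_t) = w.
    rewrite /= (pmap_filter (insubK _)); apply/all_filterP/allP => a.
    by move/(word_letter_lt Aw); rewrite isSome_insub.
  have At : word n k (map val (Tuple size_t)) by rewrite t_w.
  by exists (exist _ (Tuple size_t) At).
have rot_word (x : T) : word n k (map val (rot_tuple d (val x))).
  by rewrite map_rot perm_closed_rot ?(valP x) //; apply: word_perm_closed.
pose rot_T (x : T) : T := exist _ (rot_tuple d (val x)) (rot_word x).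
have letters_rot x : letters (rot_T x) = rot d (letters x) :> seq nat.
  by rewrite /= map_rot.
have rot_inj_T : injective rot_T.
  move=> x y eq_xy; have := letters_rot x.
  by rewrite eq_xy letters_rot => /rot_inj/val_inj/letters_inj.
have rot_overlap x : drop d (letters x) = take s (letters (perm rot_inj_T x)).
  rewrite permE letters_rot /rot take_size_cat // size_drop size_tuple /d; lia.
have [p p_overlap p_join] := successor_perm_joining
  (src := fun x => take s (letters x)) (tgt := fun x => drop d (letters x)) rot_overlap.
have linked_orbit u v : linked (word n k) d u v ->
    exists x y, [/\ letters x = u :> seq nat, letters y = v :> seq nat
                  & x \in porbit p y].
  elim=> {u v}.
  - by move=> u /letters_onto[x xu]; exists x, x; rewrite porbit_id.
  - by move=> u v _ [x [y [xu yv xy]]]; exists y, x; rewrite porbit_sym.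
  - move=> u v w _ [x [y [xu yv xy]]] _ [y' [z [y'v zw yz]]]; exists x, z; split=> //.
    have eq_y : y = y' by apply/letters_inj/val_inj; rewrite [LHS]yv [RHS]y'v.
    by move: xy yz; rewrite -eq_y -!eq_porbit_mem => /eqP->.
  - move=> u /letters_onto[x xu]; exists x, (rot_T x); rewrite letters_rot xu; split=> //.
    (* The permutation [p] may differ from the rotation. The predecessor [z] of [rot_T x] under [p]
       ends in the same [s] letters as [x], so [p_join] places [x] in the orbit of [z], which
       contains [rot_T x]. *)
    have [z rot_z] : exists z, rot_T x = p z by exists (p^-1 (rot_T x))%g; rewrite permKV.
    have : drop d (letters z) = drop d (letters x).
      by rewrite p_overlap rot_overlap permE rot_z.
    move/p_join; rewrite rot_z -!eq_porbit_mem => /eqP<-.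
    by rewrite eq_porbit_mem porbit_sym (mem_porbit p 1).
  - move=> u v /letters_onto[x xu] /letters_onto[y yv] uv.
    by exists x, y; split=> //; apply: p_join; rewrite xu yv.
have one_orbit x y : x \in porbit p y.
  have [x' [y' [xx yy]]] := linked_orbit _ _
    (linked_words k_gt0 d_n co_dn (letters_word x) (letters_word y)).
  by rewrite (letters_inj _ _ (val_inj xx)) (letters_inj _ _ (val_inj yy)).
have p_over x : overlap s (letters x) (letters (p x)) by apply/eqP/p_overlap.
have [c [c_uniq c_all c_cycle]] := one_porbit_cycle
  (e := relpre letters (@overlap s n)) p_over one_orbit.
exists (map letters c); split; first by rewrite map_inj_uniq.
  move=> w; rewrite weak_order_wtP //; split=> [/mapP[x _ ->] // |].
  move=> /letters_onto[x xw].
  by rewrite -(val_inj xw) map_f.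
by rewrite cycle_map.
Qed.
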